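(* Let $\mathcal{F}$ be a family of $n$ pseudo-discs in the plane all containing a common point $O$ in their interior. Then for every $k$ we have $g(\mathcal{F},k)\le 2(k-1)n$.
   Context: A family $\mathcal{F}$ of sets in the plane is nice if every member is a region bounded by a simple closed Jordan curve and these boundary curves are in general position: any two cross in only finitely many points, no two curves touch or overlap, and no three curves pass through a common point. A nice family is a family of pseudo-discs if the boundaries of every two of its members intersect in at most two points. For a family $\mathcal{F}$ of pseudo-discs and an integer $k$, $g(\mathcal{F},k)$ denotes the number of intersection points of two boundaries of sets in $\mathcal{F}$ that are contained in at most $k$ sets from $\mathcal{F}$.
   Formalization: The claim is stated for integers k ≥ 1 only: for k ≤ 0 and n ≥ 1 the bound 2(k-1)n is negative while g(F,k) ≥ 0, so the inequality fails there (for example one disc and k = 0). *)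

(* Defs.v *)
From mathcomp Require Import all_boot all_order all_algebra.
From mathcomp Require Import all_classical all_reals all_analysis.
Set Implicit Arguments. Unset Strict Implicit. Unset Printing Implicit Defensive.
Import Order.TTheory GRing.Theory Num.Theory.
Import numFieldNormedType.Exports.
Local Open Scope classical_set_scope.
Local Open Scope ring_scope.

Section Defs.
Variable R : realType.
Local Notation P := (R * R)%type.

Definition plane_bounded (A : set P) : Prop :=
  exists M : R, forall p, A p -> `|p.1| <= M /\ `|p.2| <= M.

Definition jordan_param (gamma : R -> P) : Prop :=
  continuous gamma /\ (forall t, gamma (t + 1) = gamma t) /\
  (forall s t, 0 <= s < 1 -> 0 <= t < 1 -> gamma s = gamma t -> s = t).

Definition curve (gamma : R -> P) : set P := range gamma.

Definition region (gamma : R -> P) : set P :=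
  curve gamma `|`
  [set p | ~ curve gamma p /\
           plane_bounded (connected_component (~` curve gamma) p)].

Definition crosses_at (gamma delta : R -> P) (t0 : R) : Prop :=
  exists2 e : R, 0 < e &
    ((forall t, t0 - e < t < t0 -> (region delta)^° (gamma t)) /\
     (forall t, t0 < t < t0 + e -> ~ region delta (gamma t))) \/
    ((forall t, t0 - e < t < t0 -> ~ region delta (gamma t)) /\
     (forall t, t0 < t < t0 + e -> (region delta)^° (gamma t))).

(* a nice family, indexed by 'I_n, given by the parametrizations of the
   boundaries *)
Definition nice_family (n : nat) (gam : 'I_n -> R -> P) : Prop :=
  (forall i, jordan_param (gam i)) /\
  (forall i j, i != j -> finite_set (curve (gam i) `&` curve (gam j))) /\
  (forall i j t, i != j -> curve (gam j) (gam i t) -> crosses_at (gam i) (gam j) t) /\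
  (forall i j l p, i != j -> j != l -> i != l ->
     ~ (curve (gam i) p /\ curve (gam j) p /\ curve (gam l) p)).

Definition pseudo_disc_family (n : nat) (gam : 'I_n -> R -> P) : Prop :=
  nice_family gam /\
  (forall i j, i != j -> forall s : seq P, uniq s ->
     (forall p, p \in s -> (curve (gam i) `&` curve (gam j)) p) ->
     (size s <= 2)%N).

Definition depth (n : nat) (gam : 'I_n -> R -> P) (p : P) : nat :=
  #|[set l : 'I_n | p \in region (gam l)]%SET|.

Definition g_vertices (n : nat) (gam : 'I_n -> R -> P) (k : nat) : set P :=
  [set p | (exists i j, i != j /\ curve (gam i) p /\ curve (gam j) p) /\
           (depth gam p <= k)%N].

(* g(F,k) <= b : every duplicate-free list of such vertices has length <= b
   (the vertex set is finite by general position) *)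
Definition g_le (n : nat) (gam : 'I_n -> R -> P) (k b : nat) : Prop :=
  forall s : seq P, uniq s -> (forall p, p \in s -> g_vertices gam k p) ->
    (size s <= b)%N.

End Defs.

(* Main.v *)
Require Import Defs.
From mathcomp Require Import all_boot all_order all_algebra.
From mathcomp Require Import all_classical all_reals all_analysis.
From mathcomp Require Import lra zify.
Import numFieldNormedType.Exports.
Import Order.TTheory GRing.Theory Num.Theory.
Local Open Scope classical_set_scope.
Local Open Scope ring_scope.

(** Shoot a ray from [O] and let [s_A] be its first point on the curve [A].
If [s_A] comes no later than [s_B] on the ray, then [s_A] lies in [B], since
the ray has not left [B] yet.  Cut [A] open at such an [s_A]: of the at most
two crossings of [A] and [B], one is joined to [s_A] inside [B] by the arc of
[A] running backwards to the cut, and the other by the arc running forwards to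
the cut.  Charge the crossing to [A], with the corresponding direction.  Fix [A]
and a direction, and take the crossing of depth at most [k] charged to [A] in
that direction which is closest to the cut: it lies in [A] and in every disc [B]
accounting for such a charge, hence there are at most [k - 1] of them. *)

Section Plane.
Variable R : realType.
Implicit Types (g d : R -> (R * R)%type) (p : (R * R)%type) (c s t u : R).

(** * Periodic parametrizations of Jordan curves, and paths avoiding them *)

Lemma jordan_period g (m : int) t : jordan_param g -> g (t + m%:~R) = g t.
Proof.
move=> [_ [per _]].
have pern (n : nat) u : g (u + n%:R) = g u.
  elim: n u => [|n IHn] u; first by rewrite addr0.
  by rewrite -natr1 addrA per IHn.
case: m => n; first exact: pern.
by rewrite NegzE -(pern n.+1 (t + _)) mulrNz subrK.
Qed.

Lemma jordan_surj g c p : jordan_param g -> curve g p ->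
  exists2 t, c <= t < c + 1 & g t = p.
Proof.
move=> jg [u _ <-]; exists (u + (- Num.floor (u - c))%:~R); last exact: jordan_period.
by have := floor_itv (u - c); rewrite intrD mulrNz; lra.
Qed.

(** Subtracting integer parts moves both parameters into the unit window, where injectivity is
    assumed; the two integer parts agree because their difference lies strictly between -1 and 1. *)
Lemma jordan_inj g c s t : jordan_param g -> c <= s < c + 1 -> c <= t < c + 1 ->
  g s = g t -> s = t.
Proof.
move=> jg cs ct.
rewrite -(jordan_period g (- Num.floor s) s jg) -(jordan_period g (- Num.floor t) t jg).
have fl (u : R) : 0 <= u + (- Num.floor u)%:~R < 1.
  by have := floor_itv u; rewrite intrD mulrNz; lra.
have [_ [_ inj]] := jg.
move=> /(inj _ _ (fl s) (fl t)); rewrite !mulrNz => e.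
have: ((Num.floor s - Num.floor t)%:~R : R) = s - t by rewrite intrB; lra.
set m := Num.floor s - Num.floor t => em.
have : m = 0.
  have /andP[m1 m2] : ((-1)%:~R : R) < m%:~R < (1%:~R : R).
    by rewrite em mulrNz; lra.
  rewrite !ltr_int in m1 m2; lia.
by move=> m0; move: em; rewrite m0; lra.
Qed.

Lemma curve_closed g : jordan_param g -> closed (curve g).
Proof.
move=> jg; apply: compact_closed; first exact: norm_hausdorff.
suff -> : curve g = g @` `[0, 1].
  apply: continuous_compact; last exact: segment_compact.
  by apply: continuous_subspaceT; case: jg.
apply/seteqP; split=> [p cp|p [t _ <-]]; last by exists t.
have [t t01 <-] := jordan_surj g 0 p jg cp.
by exists t => //; rewrite /= in_itv /=; lra.
Qed.

(** Off the curve, membership in [region d] depends only on the component of the complement, and a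
    path avoiding the curve stays in one component. *)
Lemma region_path d (f : R -> (R * R)%type) s t : continuous f -> s <= t ->
  (forall u, s <= u <= t -> ~ curve d (f u)) ->
  region d (f s) <-> region d (f t).
Proof.
move=> cf st avoid.
have comp : connected_component (~` curve d) (f s) (f t).
  exists (f @` `[s, t]); last by exists t => //; rewrite /= in_itv /= st lexx.
  split.
  - by exists s => //; rewrite /= in_itv /= st lexx.
  - by move=> _ [u + <-]; rewrite /= in_itv /=; apply: avoid.
  - apply: connected_continuous_connected; first exact: segment_connected.
    exact: continuous_subspaceT.
have nc u : s <= u <= t -> region d (f u) <->
    plane_bounded (connected_component (~` curve d) (f u)).
  by move=> /avoid nu; split=> [[//|[]]|bu] //; right.
by rewrite !nc ?st ?lexx // (same_connected_component comp).
Qed.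

(** * Rays from the common point *)

Definition ray (O : (R * R)%type) (t : R) : (R * R)%type := (O.1 + t, O.2).

Lemma ray_continuous O : continuous (ray O).
Proof.
move=> t; apply: (@cvg_pair _ _ _ _ (nbhs (O.1 + t)) (nbhs O.2) _ _ _
  (fun u => O.1 + u) (fun=> O.2)); last exact: cvg_cst.
by apply: cvgD; [exact: cvg_cst|exact: cvg_id].
Qed.

(** A ray missing the curve would be an unbounded connected set inside a bounded component; the
    infimum of the hitting parameters is attained because the curve is closed. *)
Lemma ray_first_hit O g : jordan_param g -> region g O ->
  exists t, [/\ 0 <= t, curve g (ray O t) &
                forall u, 0 <= u < t -> ~ curve g (ray O u)].
Proof.
move=> jg rO; pose S := [set t | 0 <= t /\ curve g (ray O t)].
have ray0 : ray O 0 = O by rewrite /ray addr0; case: (O).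
have S0 : S !=set0.
  apply: contrapT => /set0P/negP; rewrite negbK => /eqP S0.
  have avoid u : 0 <= u -> ~ curve g (ray O u).
    by move=> u0 cu; have : S u by []; rewrite S0.
  have [cO|[_ [M bM]]] := rO; first by apply: (avoid 0); rewrite ?ray0.
  (* Chosen so that the first coordinate of [ray O t] exceeds [M]. *)
  pose t := `|M| + `|O.1| + 1.
  have t0 : 0 <= t by rewrite /t; have := normr_ge0 M; have := normr_ge0 O.1; lra.
  have [|/= + _] := bM (ray O t).
    exists (ray O @` `[0, t]); last by exists t => //; rewrite /= in_itv /= t0 lexx.
    split.
    - by exists 0 => //; rewrite /= in_itv /= t0 lexx.
    - by move=> _ [u + <-]; rewrite /= in_itv /= => /andP[u0 _]; apply: avoid.
    - apply: connected_continuous_connected; first exact: segment_connected.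
      exact/continuous_subspaceT/ray_continuous.
  have := ler_norm M; have := ler_norm (O.1 + t); have := ler_norm (- O.1).
  by rewrite normrN /t; lra.
have lbS : lbound S 0 by move=> u [].
have hlb : has_lbound S by exists 0.
have i0 : 0 <= inf S by apply: lb_le_inf.
exists (inf S); split=> //; last first.
  move=> u /andP[u0 ui] cu; have : inf S <= u by apply: ge_inf.
  by rewrite leNgt ui.
apply: contrapT => nc.
have : nbhs (inf S) (ray O @^-1` (~` curve g)).
  apply: ray_continuous; apply: open_nbhs_nbhs; split=> //.
  exact/closed_openC/curve_closed.
move=> /nbhs_ballP[e /= e0 be].
have [u Su ue] := inf_adherent e0 (conj S0 hlb).
have iu : inf S <= u by apply: ge_inf.
by case: Su => _; apply: be; rewrite /ball /= ltr_norml; lra.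
Qed.

Lemma ray_hit_region O g t : region g O ->
  (forall u, 0 <= u < t -> ~ curve g (ray O u)) ->
  forall u, 0 <= u < t -> region g (ray O u).
Proof.
move=> rO avoid u /andP[u0 ut].
rewrite -(region_path g (ray O) 0 u) //; first by rewrite /ray addr0; case: (O) rO.
- exact: ray_continuous.
- by move=> v /andP[v0 vu]; apply: avoid; rewrite v0 (le_lt_trans vu).
Qed.

(** * Arcs joining crossings to the cut *)

Definition dir (b : bool) (t : R) : R := if b then t else - t.

(* For [g] cut open at time [c], the point [p] is joined to the cut by an arc of
   [g] inside [region d]: the arc before [p] if [b], the one after [p] otherwise. *)
Definition cut_arc g d (c : R) (b : bool) p : Prop :=
  exists t, [/\ c <= t <= c + 1, g t = p &
    forall s, c <= s <= c + 1 -> dir b s <= dir b t -> region d (g s)].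

Lemma cut_arc_at_cut g d c b : jordan_param g -> region d (g c) ->
  cut_arc g d c b (g c).
Proof.
move=> jg rc; have [_ [per _]] := jg.
(* The cut point has the two parameters [c] and [c + 1]; the one chosen here shrinks the arc in
   direction [b] to a single point. *)
exists (if b then c else c + 1); split; first by case: b; lra.
- by case: b; rewrite ?per.
- case: b => s hs /= le; first by have -> : s = c by lra.
  have -> : s = c + 1 by lra.
  by rewrite per.
Qed.

Lemma cut_arc_before g d c t : continuous g -> c <= t <= c + 1 ->
  region d (g c) -> curve d (g t) ->
  (forall u, c <= u < t -> ~ curve d (g u)) -> cut_arc g d c true (g t).
Proof.
move=> cg ct rc dt avoid; exists t; split=> //= s cs st.
have [->|nst] := eqVneq s t; first by left.
have lst : s < t by rewrite lt_neqAle nst.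
rewrite -(region_path d g c s) //; first lra.
by move=> u cu; apply: avoid; lra.
Qed.

Lemma cut_arc_after g d c t : continuous g -> c <= t <= c + 1 ->
  region d (g (c + 1)) -> curve d (g t) ->
  (forall u, t < u <= c + 1 -> ~ curve d (g u)) -> cut_arc g d c false (g t).
Proof.
move=> cg ct rc dt avoid; exists t; split=> //= s cs st.
have [->|nst] := eqVneq s t; first by left.
have lst : t < s by rewrite lt_neqAle eq_sym nst; lra.
rewrite (region_path d g s (c + 1)) //; first lra.
by move=> u cu; apply: avoid; lra.
Qed.

(* The cut may itself be a crossing here, so the status of [g] at the cut says
   nothing about the adjacent arcs: transversality at [t] decides instead. *)
Lemma cut_arc_crossing g d c t : jordan_param g -> c < t < c + 1 ->
  region d (g c) -> curve d (g t) -> crosses_at g d t ->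
  (forall u, c < u < c + 1 -> u != t -> ~ curve d (g u)) ->
  exists b, cut_arc g d c b (g t).
Proof.
move=> jg ct rc dt [e e0 cross] avoid; have [cg [per _]] := jg.
(* Halving the minimum keeps [t - h] and [t + h] both within the range controlled by the crossing
   and strictly between [c] and [c + 1]. *)
pose h := Num.min e (Num.min (t - c) (c + 1 - t)) / 2.
have h0 : 0 < h by rewrite /h divr_gt0 // !lt_min e0; apply/andP; split; lra.
have hh : h * 2 <= Num.min e (Num.min (t - c) (c + 1 - t)) by rewrite /h; lra.
move: hh; rewrite !le_min => /and3P[he h1 h2].
case: cross => [[/(_ (t - h)) inl _]|[_ /(_ (t + h)) inr]].
- have rl : region d (g (t - h)) by apply: interior_subset; apply: inl; lra.
  exists true; exists t; split=> //=; first lra.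
  move=> s cs st.
  have [->|nst] := eqVneq s t; first by left.
  have [->//|nsc] := eqVneq s c.
  have lst : s < t by rewrite lt_neqAle nst.
  have lcs : c < s by rewrite lt_neqAle eq_sym nsc; lra.
  have av u : c < u < t -> ~ curve d (g u).
    by move=> cu; apply: avoid; [lra|rewrite lt_eqF//; lra].
  have [le|/ltW le] := leP s (t - h).
    by rewrite (region_path d g s (t - h)) // => u cu; apply: av; lra.
  by rewrite -(region_path d g (t - h) s) // => u cu; apply: av; lra.
- have rr : region d (g (t + h)) by apply: interior_subset; apply: inr; lra.
  exists false; exists t; split=> //=; first lra.
  move=> s cs st.
  have [->|nst] := eqVneq s t; first by left.
  have [->|nsc] := eqVneq s (c + 1); first by rewrite per.
  have lst : t < s by rewrite lt_neqAle eq_sym nst; lra.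
  have lcs : s < c + 1 by rewrite lt_neqAle nsc; lra.
  have av u : t < u < c + 1 -> ~ curve d (g u).
    by move=> cu; apply: avoid; [lra|rewrite gt_eqF//; lra].
  have [le|/ltW le] := leP s (t + h).
    by rewrite (region_path d g s (t + h)) // => u cu; apply: av; lra.
  by rewrite -(region_path d g (t + h) s) // => u cu; apply: av; lra.
Qed.

(** If neither crossing is at the cut, the arcs of [g] from the cut to [t1] and from [t2] to the cut
    do not meet [d] on the way. If [t1] is the cut, its arc degenerates in both directions, so it
    takes the direction left free by [t2]. *)
Lemma two_crossings_cut_arcs g d c t1 t2 : jordan_param g ->
  (forall t, curve d (g t) -> crosses_at g d t) ->
  (forall p, curve g p -> curve d p -> p = g t1 \/ p = g t2) ->
  c <= t1 -> t1 < t2 -> t2 < c + 1 ->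
  region d (g c) -> curve d (g t1) -> curve d (g t2) ->
  exists b, cut_arc g d c b (g t1) /\ cut_arc g d c (~~ b) (g t2).
Proof.
move=> jg cross two ct1 t12 t2c rc d1 d2; have [cg [per _]] := jg.
have only u : c <= u < c + 1 -> curve d (g u) -> u = t1 \/ u = t2.
  move=> cu du; have [] : g u = g t1 \/ g u = g t2 by apply: two => //; exists u.
  - by left; apply: (jordan_inj g c) => //; lra.
  - by right; apply: (jordan_inj g c) => //; lra.
have [ec|nct1] := eqVneq t1 c.
  subst t1.
  have [||||//|b a2] := cut_arc_crossing g d c t2 jg => //.
  - lra.
  - exact: cross.
  - by move=> u cu /eqP ut2 /only[|uc|//]; lra.
  exists (~~ b); split; last by rewrite negbK.
  exact: cut_arc_at_cut.
have lct1 : c < t1 by rewrite lt_neqAle eq_sym nct1.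
exists true; split.
- apply: cut_arc_before => //; first lra.
  by move=> u cu /only[|uc|uc]; lra.
- apply: cut_arc_after => //; first lra.
    by rewrite per.
  move=> u cu.
  have [->|nuc] := eqVneq u (c + 1).
    by rewrite per => /only[|uc|uc]; lra.
  have luc : u < c + 1 by rewrite lt_neqAle nuc; lra.
  by move=> /only[|uc|uc]; lra.
Qed.

(** [K] records the direction of the arc; separating the two crossings by direction is what later
    makes the charging injective. *)
Lemma crossing_charge g d c : jordan_param g ->
  (forall t, curve d (g t) -> crosses_at g d t) ->
  (forall s : seq (R * R), uniq s ->
     (forall p, p \in s -> (curve g `&` curve d) p) -> (size s <= 2)%N) ->
  region d (g c) ->
  exists K : (R * R)%type -> bool,
    (forall p, curve g p -> curve d p -> cut_arc g d c (K p) p) /\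
    (forall p q, curve g p -> curve d p -> curve g q -> curve d q ->
       K p = K q -> p = q).
Proof.
move=> jg cross le2 rc; have [cg _] := jg.
have [[p [q [gp dp gq dq pq]]]|all1] := pselect (exists p q,
    [/\ curve g p, curve d p, curve g q, curve d q & p <> q]); last first.
  have eq1 p q : curve g p -> curve d p -> curve g q -> curve d q -> p = q.
    by move=> *; apply: contrapT => ?; apply: all1; exists p, q.
  (* A lone crossing may take either direction, since the rest of [g] misses [d]. *)
  exists (fun=> true); split=> [p gp dp|p q *]; last exact: eq1.
  have [t ct gt] := jordan_surj g c p jg gp.
  rewrite -gt; apply: cut_arc_before => //; [lra|by rewrite gt|].
  move=> u cu du; have : u = t; last lra.
  apply: (jordan_inj g c) => //; first lra.
  by rewrite gt; apply: eq1 => //; exists u.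
have two r : curve g r -> curve d r -> r = p \/ r = q.
  move=> gr dr; have [->|/eqP rp] := eqVneq r p; first by left.
  have [->|/eqP rq] := eqVneq r q; first by right.
  have := le2 [:: r; p; q]; rewrite /= !inE !negb_or.
  move/eqP: (rp) => ->; move/eqP: (rq) => ->; move/eqP: (pq) => -> /=.
  by move=> /(_ isT); apply: contraPP => _; apply/not_implyP; split=> // x;
     rewrite !inE => /or3P[] /eqP ->.
have [tp ctp gtp] := jordan_surj g c p jg gp.
have [tq ctq gtq] := jordan_surj g c q jg gq.
have [b [ap aq]] : exists b, cut_arc g d c b p /\ cut_arc g d c (~~ b) q.
  have [lt|lt|e] := ltgtP tp tq.
  - rewrite -gtp -gtq; apply: two_crossings_cut_arcs => //; rewrite ?gtp ?gtq //; lra.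
  - suff [b [aq ap]] : exists b, cut_arc g d c b (g tq) /\ cut_arc g d c (~~ b) (g tp).
      by exists (~~ b); rewrite negbK -gtp -gtq.
    apply: two_crossings_cut_arcs => //; rewrite ?gtp ?gtq //; [|lra|lra].
    by move=> r gr dr; have [] := two r gr dr; [right|left].
  - by case: pq; rewrite -gtp -gtq e.
have qp : (q == p) = false by apply/eqP => e; apply: pq.
exists (fun r => if r == p then b else ~~ b); split.
- by move=> r gr dr; have [->|->] := two r gr dr; rewrite ?eqxx ?qp.
- move=> r r' gr dr gr' dr'.
  by have [->|->] := two r gr dr; have [->|->] := two r' gr' dr';
    rewrite ?eqxx ?qp //; case: (b).
Qed.

(** * Counting the charges *)

Lemma cut_arc_depth n (gam : 'I_n -> R -> (R * R)%type) (k : nat) a (c : R)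
    (b : bool) (B : {set 'I_n}) :
  a \notin B ->
  (forall l, l \in B -> exists p,
     (depth gam p <= k)%N /\ cut_arc (gam a) (gam l) c b p) ->
  (#|B| <= k - 1)%N.
Proof.
move=> aB H; have [->|/set0Pn[l0 l0B]] := eqVneq B finset.set0; first by rewrite cards0.
pose Q l t := [/\ c <= t <= c + 1, (depth gam (gam a t) <= k)%N &
  forall s, c <= s <= c + 1 -> dir b s <= dir b t -> region (gam l) (gam a s)].
have [t Ht] : exists t : 'I_n -> R, forall l, l \in B -> Q l (t l).
  apply: (@fin_all_exists _ (fun=> R) (fun l t => l \in B -> Q l t)) => l.
  have [lB|] := boolP (l \in B); last by exists 0.
  have [p [dp [t [ct gt st]]]] := H l lB.
  by exists t => _; split=> //; rewrite gt.
(* Minimising [dir b] selects the crossing closest to the cut: the smallest parameter if [b] holds,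
   the largest otherwise. *)
case: (@arg_minP _ _ _ l0 (mem B) (fun l => dir b (t l)) l0B) => l lB lmin.
have [cl dl _] := Ht l lB.
(* The disc [a] contains the selected point on its own boundary, which turns [k] into [k - 1]. *)
suff : (#|a |: B| <= k)%N by rewrite cardsU1 aB; lia.
apply: leq_trans dl; apply: subset_leq_card; apply/fintype.subsetP => m.
rewrite !inE => /orP[/eqP ->|mB]; first by left; exists (t l).
by have [_ _] := Ht m mB; apply=> //; apply: lmin.
Qed.

End Plane.

Lemma card_fibers_le (I J : finType) (T : {set I * J}) (m : nat) :
  (forall i, #|[set j | (i, j) \in T]%SET| <= m)%N -> (#|T| <= #|I| * m)%N.
Proof.
move=> Hm; rewrite -sum1_card.
rewrite (eq_bigl (fun x => predT x.1 && ((x.1, x.2) \in T))) => [|[]//].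
rewrite -(pair_big_dep predT (fun i j => (i, j) \in T) (fun _ _ => 1%N)) /=.
rewrite (eq_bigr (fun i => #|[set j | (i, j) \in T]%SET|)) => [|i _]; last first.
  by rewrite -sum1_card; apply: eq_bigl => j; rewrite inE.
by rewrite -sum_nat_const; apply: leq_sum.
Qed.

Theorem theorem3 (R : realType) (n : nat) (gam : 'I_n -> R -> (R * R)%type)
  (O : (R * R)%type) (k : nat) :
  pseudo_disc_family gam ->
  (forall i, (region (gam i))^° O) ->
  (1 <= k)%N ->
  g_le gam k (2 * (k - 1) * n)%N.
Proof.
move=> [[jor [_ [cross _]]] le2] intO _ s us sv.
have rO i : region (gam i) O by apply: interior_subset; apply: intO.
have [tau Htau] := fin_all_exists (fun i => ray_first_hit R O (gam i) (jor i) (rO i)).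
have [c Hc] : exists c : 'I_n -> R, forall i, gam i (c i) = ray R O (tau i).
  apply: (@fin_all_exists _ (fun=> R) (fun i c => gam i c = ray R O (tau i))) => i.
  by have [_ [t _ <-] _] := Htau i; exists t.
(* In a tie the ray point lies on the boundary of [gam j], which belongs to its region. *)
have cut_in i j : tau i <= tau j -> region (gam j) (gam i (c i)).
  rewrite Hc le_eqVlt => /orP[/eqP ->|ij]; first by have [_ cj _] := Htau j; left.
  have [ti _ _] := Htau i; have [_ _ avoid] := Htau j.
  by apply: (ray_hit_region R O _ (tau j)) => //; rewrite ti.
pose charging (ij : 'I_n * 'I_n) (K : (R * R)%type -> bool) :=
  (forall p, curve (gam ij.1) p -> curve (gam ij.2) p ->
     cut_arc R (gam ij.1) (gam ij.2) (c ij.1) (K p) p) /\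
  (forall p q, curve (gam ij.1) p -> curve (gam ij.2) p ->
     curve (gam ij.1) q -> curve (gam ij.2) q -> K p = K q -> p = q).
have [K HK] : exists K, forall ij, ij.1 != ij.2 -> tau ij.1 <= tau ij.2 ->
    charging ij (K ij).
  apply: (@fin_all_exists _ (fun=> (R * R)%type -> bool) (fun ij K =>
    ij.1 != ij.2 -> tau ij.1 <= tau ij.2 -> charging ij K)) => -[i j] /=.
  have [->|nij] := eqVneq i j; first by exists (fun=> true).
  have [tij|] := boolP (tau i <= tau j); last by exists (fun=> true).
  have [|K [K1 K2]] := crossing_charge R (gam i) (gam j) (c i) (jor i) _
    (le2 i j nij) (cut_in i j tij).
    by move=> t; apply: cross.
  by exists K.
(* A label is grouped as (charged curve, direction), then the other curve, so that its first
   component indexes the fibres counted below. *)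
pose charged (p : (R * R)%type) (x : 'I_n * bool * 'I_n) :=
  [/\ x.1.1 != x.2, tau x.1.1 <= tau x.2, curve (gam x.1.1) p,
      curve (gam x.2) p & K (x.1.1, x.2) p = x.1.2].
have charge p : g_vertices gam k p -> exists x, charged p x.
  move=> [[i [j [nij [ci cj]]]] _].
  have [le|/ltW le] := leP (tau i) (tau j).
    by exists (i, K (i, j) p, j).
  by exists (j, K (j, i) p, i); split=> //=; rewrite eq_sym.
(* A nonempty list supplies a label [x0], the default value of [f] off the vertices; for [n = 0]
   there are no labels at all. *)
case: (s) us sv => [//|p0 s'] us sv.
have [x0 _] := charge p0 (sv p0 (mem_head _ _)).
have [f Hf] : {f & forall p, g_vertices gam k p -> charged p (f p)}.
  apply: (@boolp.choice _ _ (fun p x => g_vertices gam k p -> charged p x)) => p.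
  have [/charge[x cx]|nv] := pselect (g_vertices gam k p); first by exists x.
  by exists x0.
move: (p0 :: s') us sv => {}s us sv {s' p0 x0}.
(* Equal labels mean the same pair of curves and the same direction, hence the same crossing. *)
have finj : {in s &, injective f}.
  move=> p q /sv/Hf[nij tij ip jp Kp] /sv/Hf[_ _ iq jq Kq] e.
  rewrite -e in iq jq Kq.
  have [_ inj] := HK ((f p).1.1, (f p).2) nij tij.
  by apply: inj => //=; rewrite Kp Kq.
have ufs : uniq [seq f p | p <- s] by rewrite map_inj_in_uniq.
rewrite -(size_map f) -(card_uniqP ufs).
pose T := [set x in [seq f p | p <- s]]%SET.
have -> : #|[seq f p | p <- s]| = #|T| by rewrite cardsE.
(* There are [2 * n] pairs of a curve and a direction, each receiving at most [k - 1] charges. *)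
suff fib i : (#|[set j | (i, j) \in T]%SET| <= k - 1)%N.
  apply: leq_trans (card_fibers_le _ _ T _ fib) _.
  by rewrite card_prod card_ord card_bool; lia.
case: i => a b.
apply: (@cut_arc_depth R n gam k a (c a) b).
  rewrite !inE; apply/negP => /mapP[p /sv/Hf[+ _ _ _ _]] e.
  by rewrite -e eqxx.
move=> l; rewrite !inE => /mapP[p ps e].
exists p; have vp := sv p ps; split; first by case: vp.
have [nij tij ip jp Kp] := Hf p vp.
move: nij tij ip jp Kp; rewrite -e /= => nij tij ip jp <-.
by have [arc _] := HK (a, l) nij tij; apply: arc.
Qed.
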